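(* For any $a,b\in\mathbb{N}_0$ and $c\in\mathbb{N}$, $$t^{\star}(\{2\}^{a},c+3,\{2\}^{b})=-\frac{2}{\pi}\sum_{r=1}^{c+2}2^{r}\sum_{\substack{s_1+\cdots+s_r=c+2\\ s_1,\ldots,s_r\geq1}}t(\overline{2a+1+s_1},s_2,\ldots,s_{r-1},2b+1+s_r),$$ where for $r=1$ the term $t(\overline{2a+1+s_1},s_2,\ldots,s_{r-1},2b+1+s_r)$ means $t(\overline{2a+2b+4+c})$.
   Context: $t^{\star}(\boldsymbol{s})=\sum_{k_1\geq\cdots\geq k_r\geq1}\prod_{j}(2k_j-1)^{-s_j}$ for an index with $s_1>1$; $\{2\}^a$ is $2$ repeated $a$ times. Alternating multiple $t$-values: $t(\boldsymbol{s};\boldsymbol{\sigma})=\sum_{k_1>\cdots>k_r\geq1}\prod_{j}\frac{\sigma_j^{k_j}}{(2k_j-1)^{s_j}}$, where a bar over $s_j$ means $\sigma_j=-1$ and no bar means $\sigma_j=1$ (so only the first argument carries sign $-1$ here). *)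

(* Defs.v *)
From Stdlib Require Import Reals List.
From Coquelicot Require Import Coquelicot.
Import ListNotations.
Open Scope R_scope.

Definition lsum (l : list R) : R := fold_right Rplus 0 l.

Fixpoint tstar_trunc (s : list nat) (N : nat) : R :=
  match s with
  | [] => 1
  | s1 :: rest =>
      lsum (map (fun k => / (INR (2 * k - 1)%nat) ^ s1 * tstar_trunc rest k)
                (seq 1 N))
  end.

Definition tstar (s : list nat) : R := real (Lim_seq (tstar_trunc s)).

(* Truncated alternating multiple t-value; each index entry is (s_j, sigma_j)
   with sigma_j in {1,-1}:
   sum over N >= k1 > k2 > ... > kr >= 1 of prod sigma_j^k_j / (2k_j - 1)^s_j. *)
Fixpoint talt_trunc (s : list (nat * R)) (N : nat) : R :=
  match s with
  | [] => 1
  | (s1, sg) :: rest =>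
      lsum (map (fun k => sg ^ k / (INR (2 * k - 1)%nat) ^ s1 * talt_trunc rest (k - 1)%nat)
                (seq 1 N))
  end.

Definition talt (s : list (nat * R)) : R := real (Lim_seq (talt_trunc s)).

Fixpoint compositions (n r : nat) : list (list nat) :=
  match r with
  | O => match n with O => [[]] | _ => [] end
  | S r' => flat_map (fun s1 => map (cons s1) (compositions (n - s1)%nat r'))
                     (seq 1 n)
  end.

Fixpoint add_last (m : nat) (l : list nat) : list nat :=
  match l with
  | [] => []
  | [x] => [(x + m)%nat]
  | x :: rest => x :: add_last m rest
  end.

(* The index (bar(2a+1+s1), s2, ..., s_{r-1}, 2b+1+s_r); for r = 1 it is
   bar(2a+1+s1+2b+1). *)
Definition mk_index (a b : nat) (l : list nat) : list (nat * R) :=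
  match add_last (2 * b + 1)%nat l with
  | [] => []
  | x :: rest => ((2 * a + 1 + x)%nat, -1) :: map (fun s => (s, 1)) rest
  end.

Definition twos (a : nat) : list nat := repeat 2%nat a.

Example ex_comp : compositions 3 2 = [[1;2];[2;1]]%nat. Proof. reflexivity. Qed.
Example ex_idx : map fst (mk_index 1 2 [3;4;5]%nat) = [6;4;10]%nat. Proof. reflexivity. Qed.
Example ex_idx1 : map fst (mk_index 1 2 [3]%nat) = [11]%nat. Proof. reflexivity. Qed.

(* Main.v *)
Require Import Defs.
From Stdlib Require Import Reals List Lra Lia.
From Coquelicot Require Import Coquelicot.
Import ListNotations.
Open Scope R_scope.

(** With K = 2k-1 and g_k(p) = prod_{m<k} (1 - P^2/M^2), put
    q_n(p) = sum_{k<=p} K^{-n} h_b(k) g_k(p), where h_b(k) is the truncation of t*({2}^b) at k.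
    Since (P-K) g_k(p) = (P+K-2) g_k(p-1), the q_n satisfy
    P q_{n+1}(p) = q_n(p) + 2 sum_{j<p} q_n(j), which is also the recurrence in n of the sum
    over compositions of n in the theorem, weighted by 2^r and restricted to k_1 = p (up to
    the factor P^{-2a-1}). Hence the latter equals 2 q_{n+1}(p).
    On the other side, partial fractions give, for the truncation at N,
    t*_N({2}^a, n, {2}^b) = sum_{p<=N} D_N(p) P^{-2a} q_n(p) with
    D_N(p) = prod_{m<=N, m<>p} M^2/(M^2 - P^2), and P |D_N(p)| is bounded and tends to 4/pi.
    Dominated convergence for series concludes. In the code indices start at 0,
    so that K is [od k] = 2k+1. *)

(** * Finite sums over initial segments and over lists *)

Fixpoint psum (f : nat -> R) (N : nat) : R :=
  match N with O => 0 | S n => psum f n + f n end.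

Definition od (k : nat) : R := 2 * INR k + 1.

Lemma od_pos k : 0 < od k.
Proof. unfold od. pose proof (pos_INR k). lra. Qed.

Lemma od_neq0 k : od k <> 0.
Proof. pose proof (od_pos k). lra. Qed.

Lemma od_S k : od (S k) = od k + 2.
Proof. unfold od. rewrite S_INR. lra. Qed.

Lemma INR_odd k : INR (2 * S k - 1) = od k.
Proof.
  replace (2 * S k - 1)%nat with (2 * k + 1)%nat by lia.
  unfold od. rewrite plus_INR, mult_INR. simpl. lra.
Qed.

Lemma psum_ext f f' N : (forall k, (k < N)%nat -> f k = f' k) -> psum f N = psum f' N.
Proof.
  induction N as [|N IH]; intros E; simpl; [reflexivity|].
  rewrite IH, E; auto.
Qed.

Lemma psum_scal c f N : psum (fun k => c * f k) N = c * psum f N.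
Proof. induction N as [|N IH]; simpl; [|rewrite IH]; ring. Qed.

Lemma psum_plus f f' N : psum (fun k => f k + f' k) N = psum f N + psum f' N.
Proof. induction N as [|N IH]; simpl; [|rewrite IH]; ring. Qed.

Lemma psum_eq0 f N : (forall k, (k < N)%nat -> f k = 0) -> psum f N = 0.
Proof.
  intros E. rewrite (psum_ext f (fun _ => 0 * 0)) by (intros; rewrite E; auto; ring).
  rewrite psum_scal. ring.
Qed.

Lemma psum_first f N : psum f (S N) = f O + psum (fun k => f (S k)) N.
Proof. induction N as [|N IH]; [simpl; ring|]. simpl in *. rewrite IH. ring. Qed.

Lemma psum_extend f N M :
  (N <= M)%nat -> (forall k, (N <= k)%nat -> f k = 0) -> psum f M = psum f N.
Proof.
  intros L Z. induction L as [|M L IH]; [reflexivity|]. simpl. rewrite IH, Z by lia. ring.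
Qed.

Lemma psum_swap f N M :
  psum (fun i => psum (f i) M) N = psum (fun j => psum (fun i => f i j) N) M.
Proof.
  induction N as [|N IH]; simpl.
  - symmetry. apply psum_eq0. reflexivity.
  - rewrite IH, <- psum_plus. reflexivity.
Qed.

Lemma sum_f_R0_psum f n : sum_f_R0 f n = psum f (S n).
Proof. induction n as [|n IH]; [simpl; ring|]. simpl in *. rewrite IH. ring. Qed.

Lemma lsum_app l l' : lsum (l ++ l') = lsum l + lsum l'.
Proof. unfold lsum. induction l as [|x l IH]; simpl; [|rewrite IH]; ring. Qed.

Lemma lsum_seq f m N : lsum (map f (seq m N)) = psum (fun k => f (m + k)%nat) N.
Proof.
  induction N as [|N IH]; [reflexivity|].
  rewrite seq_S, map_app, lsum_app, IH. unfold lsum. simpl. ring.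
Qed.

Lemma lsum_seq1 f N : lsum (map f (seq 1 N)) = psum (fun k => f (S k)) N.
Proof. apply lsum_seq. Qed.

Lemma lsum_ext {A : Type} (f f' : A -> R) l :
  (forall x, In x l -> f x = f' x) -> lsum (map f l) = lsum (map f' l).
Proof. intros E. f_equal. now apply map_ext_in. Qed.

Lemma lsum_scal {A : Type} c (f : A -> R) l : lsum (map (fun x => c * f x) l) = c * lsum (map f l).
Proof. unfold lsum. induction l as [|x l IH]; simpl; [|rewrite IH]; ring. Qed.

Lemma lsum_plus {A : Type} (f f' : A -> R) l :
  lsum (map (fun x => f x + f' x) l) = lsum (map f l) + lsum (map f' l).
Proof. unfold lsum. induction l as [|x l IH]; simpl; [|rewrite IH]; ring. Qed.

Lemma lsum_flat_map {A B : Type} (f : A -> R) (F : B -> list A) l :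
  lsum (map f (flat_map F l)) = lsum (map (fun x => lsum (map f (F x))) l).
Proof.
  induction l as [|x l IH]; [reflexivity|].
  simpl. rewrite map_app, lsum_app, IH. reflexivity.
Qed.

Lemma psum_lsum {A : Type} (f : A -> nat -> R) l N :
  psum (fun p => lsum (map (fun x => f x p) l)) N = lsum (map (fun x => psum (f x) N) l).
Proof.
  induction N as [|N IH]; simpl.
  - unfold lsum. induction l as [|x l IHl]; simpl; [|rewrite <- IHl]; ring.
  - rewrite IH, <- lsum_plus. reflexivity.
Qed.

Lemma is_lim_seq_lsum {A : Type} (u : A -> nat -> R) (v : A -> R) l :
  (forall x, In x l -> is_lim_seq (u x) (v x)) ->
  is_lim_seq (fun N => lsum (map (fun x => u x N) l)) (lsum (map v l)).
Proof.
  induction l as [|x l IH]; intros C; unfold lsum; simpl.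
  - apply is_lim_seq_const.
  - apply is_lim_seq_plus'; [apply C; now left|apply IH; intros y Hy; apply C; now right].
Qed.

Lemma tstar_trunc_cons s l N :
  tstar_trunc (s :: l) N = psum (fun k => / od k ^ s * tstar_trunc l (S k)) N.
Proof.
  cbn [tstar_trunc]. rewrite lsum_seq1. apply psum_ext. intros k _. now rewrite INR_odd.
Qed.

Lemma talt_trunc_cons s sg l N :
  talt_trunc ((s, sg) :: l) N = psum (fun k => sg ^ S k / od k ^ s * talt_trunc l k) N.
Proof.
  cbn [talt_trunc]. rewrite lsum_seq1. apply psum_ext. intros k _.
  rewrite INR_odd. now replace (S k - 1)%nat with k by lia.
Qed.

(** * The finite partial-fraction kernel *)

Fixpoint gker (p k : nat) : R :=
  match k with O => 1 | S m => gker p m * (1 - od p ^ 2 / od m ^ 2) end.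

(** The factor at [m = p] is zero, so every sum over [k] against [gker p k] is finite. *)
Lemma gker_eq0 p k : (p < k)%nat -> gker p k = 0.
Proof.
  intros L. induction L as [|k L IH]; simpl.
  - field. apply od_neq0.
  - rewrite IH. ring.
Qed.

(** Each factor is (M - P)(M + P) / M^2, and replacing P by P + 2 moves both linear products by one
    place, so only end factors survive. The form without division also covers [k = S p], where both
    sides vanish. *)
Lemma gker_shift p k :
  (od (S p) - od k) * gker (S p) k = (od p + od k) * gker p k.
Proof.
  induction k as [|k IH].
  - rewrite od_S. unfold od. simpl. ring.
  - cbn [gker]. rewrite (od_S k).
    assert (E : (od (S p) - (od k + 2)) * (gker (S p) k * (1 - od (S p) ^ 2 / od k ^ 2))
      = ((od (S p) - od k) * gker (S p) k)
        * ((od (S p) + od k) * (od k + 2 - od (S p)) / od k ^ 2)).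
    { field. apply od_neq0. }
    rewrite E, IH, od_S. field. apply od_neq0.
Qed.

Definition qsum (h : nat -> R) (n p : nat) : R :=
  psum (fun k => h k / od k ^ n * gker p k) (S p).

Lemma qsum_step h n p :
  od (S p) * qsum h (S n) (S p) - od p * qsum h (S n) p = qsum h n (S p) + qsum h n p.
Proof.
  (* The zero term at [k = S p] gives all four sums a common range, so the identity can be checked
     term by term. *)
  assert (X : forall m, qsum h m p = psum (fun k => h k / od k ^ m * gker p k) (S (S p))).
  { intros m. symmetry. apply psum_extend; [lia|].
    intros k L. rewrite gker_eq0 by lia. ring. }
  rewrite !X. unfold qsum.
  assert (E : forall x y z, x = y + z -> x - y = z) by (intros; lra). apply E.
  rewrite <- !psum_scal, <- !psum_plus.
  apply psum_ext. intros k _. apply Rminus_diag_uniq.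
  transitivity (h k / od k ^ S n * ((od (S p) - od k) * gker (S p) k - (od p + od k) * gker p k)).
  - simpl. field. split; [apply pow_nonzero|]; apply od_neq0.
  - rewrite gker_shift. ring.
Qed.

(** [qsum_step] telescopes over [p]; at [p = 0] both sides equal [h 0]. *)
Lemma qsum_rec h n p :
  od p * qsum h (S n) p = qsum h n p + 2 * psum (qsum h n) p.
Proof.
  induction p as [|p IH].
  - unfold qsum, od. simpl. field. rewrite Rmult_0_r, Rplus_0_l, pow1. lra.
  - pose proof (qsum_step h n p). simpl psum. lra.
Qed.

(** Star sums allow equal indices, hence the cut at [S k] with indices starting at 0. *)
Definition hstar (b k : nat) : R := tstar_trunc (twos b) (S k).

Lemma hstar_S b k : hstar (S b) k = psum (fun j => / od j ^ 2 * hstar b j) (S k).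
Proof. exact (tstar_trunc_cons 2 (twos b) (S k)). Qed.

(** Abel summation, meant for [G = gker p], whose boundary value at [n = S p] is zero. *)
Lemma psum_by_parts (u G : nat -> R) n :
  psum (fun k => (G k - G (S k)) * psum u (S k)) n
  = psum (fun j => u j * G j) n - G n * psum u n.
Proof.
  induction n as [|n IH]; simpl in *; [ring|]. rewrite IH. ring.
Qed.

Lemma gker_diff p k : gker p k / od k ^ 2 = / od p ^ 2 * (gker p k - gker p (S k)).
Proof. simpl. field. split; apply od_neq0. Qed.

(** By [gker_diff] the factor 1/K^2 turns g_k into a difference; Abel summation then strips one
    entry 2 from h_b and leaves a factor P^(-2). This is the starting value of the recurrence in
    [n]. *)
Lemma qsum_hstar_2 b p : qsum (hstar b) 2 p = / od p ^ (2 * b + 2).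
Proof.
  assert (R : forall h, qsum h 2 p
     = / od p ^ 2 * psum (fun k => (gker p k - gker p (S k)) * h k) (S p)).
  { intros h. unfold qsum. rewrite <- psum_scal. apply psum_ext. intros k _.
    replace (h k / od k ^ 2 * gker p k) with (gker p k / od k ^ 2 * h k)
      by (unfold Rdiv; ring).
    rewrite gker_diff. ring. }
  induction b as [|b IH]; rewrite R.
  - replace (psum _ (S p)) with 1; [simpl; ring|].
    replace 1 with (gker p 0 - gker p (S p)) by (rewrite (gker_eq0 p (S p)) by lia; simpl; ring).
    generalize (S p) as n. induction n as [|n IH]; simpl in *; [ring|].
    rewrite <- IH. unfold hstar. simpl. ring.
  - rewrite (psum_ext _ (fun k => (gker p k - gker p (S k))
              * psum (fun j => / od j ^ 2 * hstar b j) (S k)))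
      by (intros; now rewrite hstar_S).
    rewrite psum_by_parts, (gker_eq0 p (S p)), Rmult_0_l, Rminus_0_r by lia.
    replace (psum _ (S p)) with (qsum (hstar b) 2 p).
    + rewrite IH. replace (2 * S b + 2)%nat with (2 + (2 * b + 2))%nat by lia.
      rewrite (pow_add _ 2), Rinv_mult. reflexivity.
    + apply psum_ext. intros k _. unfold Rdiv. ring.
Qed.

(** * The generating sum over compositions *)

(** The term of [talt (mk_index a b l)] with outermost index [p], stripped of its sign and of
    P^(-2a-1). *)
Definition cterm (b : nat) (l : list nat) (p : nat) : R :=
  match add_last (2 * b + 1) l with
  | [] => 0
  | x :: rest => / od p ^ x * talt_trunc (map (fun s => (s, 1)) rest) p
  end.

Definition csum (b n r p : nat) : R :=
  lsum (map (fun l => cterm b l p) (compositions n r)).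

Lemma cterm_cons b x l p :
  l <> [] -> cterm b (x :: l) p = / od p ^ x * psum (cterm b l) p.
Proof.
  destruct l as [|y l]; [easy|intros _].
  unfold cterm. change (add_last (2 * b + 1) (x :: y :: l))
    with (x :: add_last (2 * b + 1) (y :: l)).
  destruct (add_last (2 * b + 1) (y :: l)) as [|z t] eqn:E.
  - now destruct l.
  - cbn [map]. rewrite talt_trunc_cons. f_equal. apply psum_ext. intros k _.
    rewrite pow1. unfold Rdiv. ring.
Qed.

Lemma compositions_pos n r l : In l (compositions n r) -> length l = r /\ List.Forall (le 1) l.
Proof.
  revert n l. induction r as [|r IH]; intros n l.
  - simpl. destruct n; simpl; [intros [<-|[]]; auto|easy].
  - simpl. intros H. apply in_flat_map in H as (s & Hs & H).
    apply in_map_iff in H as (l' & <- & H). apply IH in H as [E F].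
    apply in_seq in Hs. split; [simpl; lia|constructor; [lia|assumption]].
Qed.

Lemma compositions_nil n r : (n < r)%nat -> compositions n r = [].
Proof.
  revert n. induction r as [|r IH]; intros n L; [lia|]. simpl.
  assert (H : forall s, In s (seq 1 n) -> (1 <= s <= n)%nat)
    by (intros s Hs; apply in_seq in Hs; lia).
  revert H. generalize (seq 1 n) as t. induction t as [|s t IHt]; intros H; [reflexivity|].
  simpl. rewrite IH, IHt; [reflexivity| |].
  - intros; apply H; now right.
  - specialize (H s (or_introl eq_refl)). lia.
Qed.

Lemma csum_unfold b n r p :
  csum b n (S r) p = psum (fun s => lsum (map (fun l => cterm b (S s :: l) p)
                                           (compositions (n - S s) r))) n.
Proof.
  unfold csum. simpl compositions. rewrite lsum_flat_map, lsum_seq1.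
  apply psum_ext. intros s _. now rewrite map_map.
Qed.

Lemma csum_1 b n p : csum b (S n) 1 p = / od p ^ (2 * b + 2 + n).
Proof.
  rewrite csum_unfold. cbn [psum]. rewrite psum_eq0.
  - replace (S n - S n)%nat with 0%nat by lia. unfold cterm, lsum.
    cbn [compositions map add_last talt_trunc fold_right].
    replace (S n + (2 * b + 1))%nat with (2 * b + 2 + n)%nat by lia. ring.
  - intros s L. replace (S n - S s)%nat with (S (n - S s)) by lia. reflexivity.
Qed.

Lemma csum_SS b n r p :
  csum b n (S (S r)) p
  = psum (fun s => / od p ^ S s * psum (csum b (n - S s) (S r)) p) n.
Proof.
  rewrite csum_unfold. apply psum_ext. intros s _. unfold csum.
  rewrite psum_lsum, <- lsum_scal.
  apply lsum_ext. intros l Hl. apply cterm_cons. intros ->.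
  now apply compositions_pos in Hl.
Qed.

(** Multiplying by P lowers the first part by one. If that part was 1 it disappears, leaving a
    composition of [n] with one part fewer, whose outermost index runs below [p]. *)
Lemma csum_rec b n r p :
  od p * csum b (S n) (S (S r)) p = csum b n (S (S r)) p + psum (csum b n (S r)) p.
Proof.
  rewrite !csum_SS, psum_first, Rmult_plus_distr_l, Rplus_comm, <- psum_scal.
  f_equal.
  - apply psum_ext. intros s _. simpl. field. split; [apply pow_nonzero|]; apply od_neq0.
  - replace (S n - 1)%nat with n by lia. simpl. field. apply od_neq0.
Qed.

Definition wsum (b n p : nat) : R := psum (fun r => 2 ^ S r * csum b n (S r) p) n.

(** [csum_rec] summed over the number of parts: the weight 2^r turns the loss of one part into the
    factor 2. Compositions with a single part are treated by [csum_1]. *)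
Lemma wsum_rec b n p :
  od p * wsum b (S (S n)) p = wsum b (S n) p + 2 * psum (wsum b (S n)) p.
Proof.
  (* There is no composition of [S n] into [S (S n)] parts, so the range can be lengthened to that
     of the left-hand side. *)
  assert (X : wsum b (S n) p = psum (fun r => 2 ^ S r * csum b (S n) (S r) p) (S (S n))).
  { unfold wsum. symmetry. apply psum_extend; [lia|]. intros k Hk.
    unfold csum. rewrite compositions_nil by lia. unfold lsum. simpl. ring. }
  rewrite X. unfold wsum at 1. rewrite !(psum_first _ (S n)).
  assert (Y : 2 * psum (wsum b (S n)) p
     = psum (fun r => 2 ^ S (S r) * psum (csum b (S n) (S r)) p) (S n)).
  { unfold wsum. rewrite psum_swap, <- psum_scal. apply psum_ext. intros r _.
    rewrite psum_scal. simpl. ring. }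
  rewrite Y, Rplus_assoc, <- psum_plus, Rmult_plus_distr_l, <- psum_scal. f_equal.
  - rewrite !csum_1. replace (2 * b + 2 + S n)%nat with (S (2 * b + 2 + n)) by lia.
    simpl. field. split; [apply pow_nonzero|]; apply od_neq0.
  - apply psum_ext. intros r _. rewrite <- Rmult_plus_distr_l, <- csum_rec. ring.
Qed.

(** [wsum_rec] and [qsum_rec] are the same recurrence, which fixes level [n + 1] from the values of
    level [n] at all [j <= p]; the levels agree at [n = 0] by [qsum_hstar_2]. *)
Lemma wsum_qsum b n p : wsum b (S n) p = 2 * qsum (hstar b) (S (S n)) p.
Proof.
  revert p. induction n as [|n IH]; intros p.
  - rewrite qsum_hstar_2. unfold wsum. simpl psum. rewrite csum_1.
    replace (2 * b + 2 + 0)%nat with (2 * b + 2)%nat by lia. ring.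
  - apply (Rmult_eq_reg_l (od p)); [|apply od_neq0].
    rewrite wsum_rec.
    replace (od p * (2 * qsum (hstar b) (S (S (S n))) p))
      with (2 * (od p * qsum (hstar b) (S (S (S n))) p)) by ring.
    rewrite qsum_rec, IH, (psum_ext _ (fun p => 2 * qsum (hstar b) (S (S n)) p))
      by (intros; apply IH).
    rewrite psum_scal. ring.
Qed.

(** * Truncated star values as weighted sums *)

(** For [N >= 1] this is the ratio of binomial coefficients C(2N-1, N+p) / C(2N-1, N). *)
Fixpoint rfac (N p : nat) : R :=
  match p with
  | O => 1
  | S j => rfac N j * ((INR N - INR (S j)) / (INR N + INR (S j)))
  end.

(** A partial Wallis product, 3^2/(2*4) * 5^2/(4*6) * ..., equal to [dker (S n) 0]. *)
Fixpoint wal (n : nat) : R :=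
  match n with
  | O => 1
  | S m => wal m * (od (S m) ^ 2 / (4 * INR (S m) * INR (S (S m))))
  end.

(** P |D_N(p)|, split into its value [wal] at [p = 0] and a ratio that decreases in [p] and tends to
    1 as [N] grows. *)
Definition ewt (N p : nat) : R :=
  match N with O => 0 | S n => wal n * rfac (S n) p end.

(* The product of [od m ^ 2 / (od m ^ 2 - od p ^ 2)] over [m < N], [m <> p], and 0 when [N <= p]. *)
Definition dker (N p : nat) : R := (-1) ^ p * ewt N p / od p.

Lemma INR_S_pos n : 0 < INR (S n).
Proof. apply lt_0_INR. lia. Qed.

Lemma rfac_eq0 N p : (0 < N)%nat -> (N <= p)%nat -> rfac N p = 0.
Proof.
  intros P L. destruct N as [|N]; [lia|]. induction L as [|p L IH].
  - cbn [rfac]. replace (INR (S N) - INR (S N)) with 0 by ring. unfold Rdiv. ring.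
  - cbn [rfac]. rewrite IH. ring.
Qed.

(** Raising [N] by one shifts the factors N - j and N + j by one place, so the quotient reduces to
    end factors. *)
Lemma rfac_shift N p : (0 < N)%nat ->
  rfac (S N) p * (INR N - INR p) * (INR N + INR p + 1) = INR N * (INR N + 1) * rfac N p.
Proof.
  intros P. induction p as [|p IH].
  - simpl. ring.
  - cbn [rfac]. rewrite !S_INR.
    pose proof (pos_INR N). pose proof (pos_INR p).
    transitivity (rfac (S N) p * (INR N - INR p) * (INR N + INR p + 1)
                  * ((INR N - (INR p + 1)) / (INR N + (INR p + 1)))).
    + field. lra.
    + rewrite IH. ring.
Qed.

Lemma ewt_eq0 N p : (N <= p)%nat -> ewt N p = 0.
Proof.
  intros L. destruct N as [|N]; [reflexivity|]. simpl ewt.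
  rewrite rfac_eq0 by lia. ring.
Qed.

Lemma dker_eq0 N p : (N <= p)%nat -> dker N p = 0.
Proof. intros L. unfold dker. rewrite ewt_eq0 by assumption. unfold Rdiv. ring. Qed.

(** Going from [N] to [S N] adjoins the factor at [m = N] to the product; for [p = N] both sides are
    zero. *)
Lemma dker_rec N p : dker (S N) p * (1 - od p ^ 2 / od N ^ 2) = dker N p.
Proof.
  destruct N as [|n].
  - destruct p as [|p].
    + unfold dker, od. simpl. field.
    + rewrite !dker_eq0 by lia. ring.
  - unfold dker, ewt. cbn [wal].
    pose proof (rfac_shift (S n) p ltac:(lia)) as E.
    pose proof (INR_S_pos n). pose proof (od_pos p). pose proof (od_pos (S n)).
    transitivity ((-1) ^ p / od p * (wal n / (INR (S n) * (INR (S n) + 1)))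
      * (rfac (S (S n)) p * (INR (S n) - INR p) * (INR (S n) + INR p + 1))).
    + rewrite (S_INR (S n)). replace (1 - od p ^ 2 / od (S n) ^ 2)
        with (4 * (INR (S n) - INR p) * (INR (S n) + INR p + 1) / od (S n) ^ 2).
      * field. lra.
      * unfold od in *. field. lra.
    + rewrite E. field. lra.
Qed.

(** The increment in [N] has the shape of a star sum with leading entry 2, at the price of a factor
    P^2 on [f]. *)
Lemma psum_dker_rec f N :
  psum (fun p => dker (S N) p * f p) (S N) - psum (fun p => dker N p * f p) N
  = / od N ^ 2 * psum (fun p => dker (S N) p * (od p ^ 2 * f p)) (S N).
Proof.
  rewrite <- (psum_extend (fun p => dker N p * f p) N (S N))
    by (try lia; intros; rewrite dker_eq0 by lia; ring).
  rewrite <- psum_scal.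
  assert (E : forall a b c, a = b + c -> a - b = c) by (intros; lra). apply E.
  rewrite <- psum_plus. apply psum_ext. intros p _.
  rewrite <- (dker_rec N p). field. apply od_neq0.
Qed.

(** At [p = N] the two products have reciprocal factors. As [dker] is given in closed form, the
    proof compares the ratios of successive diagonal values instead. *)
Lemma dker_gker_diag N : dker (S N) N * gker N N = 1.
Proof.
  induction N as [|N IH].
  - unfold dker, od. simpl. field.
  - pose proof (od_pos N). pose proof (INR_S_pos N). pose proof (od_pos (S N)).
    assert (G : gker (S N) (S N) = gker N N * (- (8 * INR (S N)) / od N)).
    { cbn [gker]. pose proof (gker_shift N N) as E.
      replace (od (S N) - od N) with 2 in E by (rewrite od_S; ring).
      replace (gker (S N) N) with (od N * gker N N) by lra.
      rewrite S_INR. unfold od in *. rewrite S_INR. field. lra. }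
    assert (D : dker (S (S N)) (S N) = dker (S N) N * (- od N / (8 * INR (S N)))).
    { unfold dker, ewt. cbn [wal]. pose proof (rfac_shift (S N) N ltac:(lia)) as E.
      change (rfac (S (S N)) (S N)) with
        (rfac (S (S N)) N * ((INR (S (S N)) - INR (S N)) / (INR (S (S N)) + INR (S N)))).
      replace (rfac (S (S N)) N) with (INR (S (S N)) / 2 * rfac (S N) N).
      - rewrite !S_INR in *. unfold od in *. rewrite S_INR. simpl pow. field. lra.
      - rewrite (S_INR (S N)).
        apply (Rmult_eq_reg_r ((INR (S N) - INR N) * (INR (S N) + INR N + 1))).
        + rewrite <- !Rmult_assoc in *. rewrite E. rewrite !S_INR. field.
        + rewrite !S_INR in *. nra. }
    rewrite G, D. transitivity (dker (S N) N * gker N N); [field; lra|exact IH].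
Qed.

(** This is the partial-fraction identity: it gives every [k] coefficient 1 in [tstar_trunc_dker].
    Induction on [N], and for each [N] downwards in [k] from the diagonal, where only [p = k]
    contributes. *)
Lemma psum_dker_gker N k : (k <= N)%nat -> psum (fun p => dker (S N) p * gker p k) (S N) = 1.
Proof.
  revert k. induction N as [|N IHN]; intros k L.
  - replace k with O by lia. unfold dker, od. simpl. field.
  - remember (S N - k)%nat as d eqn:E. revert k L E.
    induction d as [|d IHd]; intros k L E.
    + replace k with (S N) by lia. cbn [psum].
      rewrite psum_eq0, dker_gker_diag by (intros; rewrite gker_eq0 by lia; ring).
      rewrite gker_eq0 by lia. ring.
    + pose proof (psum_dker_rec (fun p => gker p k) (S N)) as R.
      cbv beta in R. rewrite (IHN k) in R by lia.
      (* P^2 g_k equals K^2 (g_k - g_(k+1)), and the sum for [S k] is already known to be 1. *)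
      assert (Q : psum (fun p => dker (S (S N)) p * (od p ^ 2 * gker p k)) (S (S N))
        = od k ^ 2 * (psum (fun p => dker (S (S N)) p * gker p k) (S (S N)) - 1)).
      { rewrite <- (IHd (S k)) by lia.
        assert (M : forall x y, x - y = x + (-1) * y) by (intros; ring).
        rewrite M, <- psum_scal, <- psum_plus, <- psum_scal.
        apply psum_ext. intros p _. cbn [gker]. field. apply od_neq0. }
      rewrite Q in R.
      assert (P : od k < od (S N)).
      { unfold od. assert (INR k < INR (S N)) by (apply lt_INR; lia). lra. }
      pose proof (od_pos k). pose proof (od_pos (S N)).
      set (x := psum _ (S (S N))) in *.
      (* [R] and [Q] express x - 1 as K^2 / (od (S N))^2 times itself, and that ratio is below 1. *)
      assert (F : (x - 1) * (od (S N) ^ 2 - od k ^ 2) = 0).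
      { replace ((x - 1) * (od (S N) ^ 2 - od k ^ 2))
          with (od (S N) ^ 2 * ((x - 1) - / od (S N) ^ 2 * (od k ^ 2 * (x - 1))))
          by (field; lra).
        rewrite <- R. ring. }
      apply Rmult_integral in F as [F|F]; [lra|nra].
Qed.

(** For [a = 0], exchanging the sums leaves the coefficients of [psum_dker_gker]. Prepending a 2
    yields on both sides the increments in [N] of [psum_dker_rec]. *)
Lemma tstar_trunc_dker a b n N :
  tstar_trunc (twos a ++ [n] ++ twos b) N
  = psum (fun p => dker N p * (qsum (hstar b) n p / od p ^ (2 * a))) N.
Proof.
  revert N. induction a as [|a IH]; intros N.
  - change (twos 0 ++ [n] ++ twos b) with (n :: twos b). rewrite tstar_trunc_cons.
    destruct N as [|N]; [reflexivity|]. symmetry.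
    transitivity (psum (fun p => psum (fun k => hstar b k / od k ^ n * (dker (S N) p * gker p k)) (S N)) (S N)).
    + apply psum_ext. intros p L. unfold qsum.
      (* Terms with [k > p] vanish, so the triangle extends to a square before the exchange. *)
      rewrite <- (psum_extend _ (S p) (S N))
        by (try lia; intros; rewrite gker_eq0 by lia; ring).
      simpl Nat.mul. rewrite pow_O, Rdiv_1_r, <- psum_scal.
      apply psum_ext. intros. ring.
    + rewrite psum_swap. apply psum_ext. intros k L.
      rewrite psum_scal, psum_dker_gker by lia. unfold hstar, Rdiv. ring.
  - change (twos (S a) ++ [n] ++ twos b) with (2%nat :: (twos a ++ [n] ++ twos b)).
    rewrite tstar_trunc_cons.
    induction N as [|N IHN]; [reflexivity|].
    cbn [psum] in IHN |- *. rewrite IHN.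
    pose proof (psum_dker_rec (fun p => qsum (hstar b) n p / od p ^ (2 * S a)) N) as R.
    rewrite IH. cbn [psum] in R |- *.
    rewrite (psum_ext (fun p => dker (S N) p * (od p ^ 2 * (qsum (hstar b) n p / od p ^ (2 * S a))))
       (fun p => dker (S N) p * (qsum (hstar b) n p / od p ^ (2 * a)))) in R.
    2: { intros p _. replace (2 * S a)%nat with (2 + 2 * a)%nat by lia.
         rewrite (pow_add _ 2). field. split; [apply pow_nonzero|]; apply od_neq0. }
    replace (od N ^ 2 * (qsum (hstar b) n N / od N ^ (2 * S a)))
      with (qsum (hstar b) n N / od N ^ (2 * a)) in R.
    2: { replace (2 * S a)%nat with (2 + 2 * a)%nat by lia.
         rewrite (pow_add _ 2). field. split; [apply pow_nonzero|]; apply od_neq0. }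
    lra.
Qed.

(** * Limits *)

(** Exchange of limits: [A j] approximates [u] within [d j], uniformly in [N]. *)
Lemma is_lim_seq_double (u : nat -> R) (l : R) (A : nat -> nat -> R) (A' d : nat -> R) :
  is_lim_seq d 0 ->
  (forall j N, Rabs (u N - A j N) <= d j) ->
  (forall j, Rabs (l - A' j) <= d j) ->
  (forall j, is_lim_seq (A j) (A' j)) ->
  is_lim_seq u l.
Proof.
  intros Hd Hu Hl HA. apply is_lim_seq_spec. intros eps.
  (* The error [d j] is spent twice, hence a quarter of [eps] for it and a half for [A j]. *)
  apply is_lim_seq_spec in Hd. destruct (Hd (pos_div_2 (pos_div_2 eps))) as [j Hj].
  specialize (Hj j (le_n j)). specialize (HA j). apply is_lim_seq_spec in HA.
  destruct (HA (pos_div_2 eps)) as [N0 HN]. exists N0. intros N L. specialize (HN N L).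
  simpl in Hj, HN. rewrite Rminus_0_r in Hj. apply Rabs_lt_between in Hj.
  pose proof (Hu j N) as B1. pose proof (Hl j) as B2.
  apply Rabs_le_between in B1. apply Rabs_le_between in B2. apply Rabs_lt_between in HN.
  apply Rabs_lt_between. lra.
Qed.

Lemma is_lim_seq_inv_INR (c : R) : is_lim_seq (fun N => / (INR N + c)) 0.
Proof.
  apply (is_lim_seq_inv (fun N => INR N + c) p_infty); [|discriminate].
  apply (is_lim_seq_plus _ _ p_infty c p_infty);
    [apply is_lim_seq_INR|apply is_lim_seq_const|reflexivity].
Qed.

Lemma is_lim_seq_inv_od : is_lim_seq (fun N => / od N) 0.
Proof.
  apply (is_lim_seq_ext (fun N => / 2 * / (INR N + / 2))).
  - intros N. unfold od. pose proof (pos_INR N). field. lra.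
  - replace 0 with (/ 2 * 0) by ring.
    apply (is_lim_seq_scal_l _ (/ 2) 0), is_lim_seq_inv_INR.
Qed.

Lemma is_lim_seq_psum (u : nat -> nat -> R) (v : nat -> R) n :
  (forall k, is_lim_seq (fun N => u N k) (v k)) ->
  is_lim_seq (fun N => psum (u N) n) (psum v n).
Proof.
  intros C. induction n as [|n IH]; simpl.
  - apply is_lim_seq_const.
  - now apply is_lim_seq_plus'.
Qed.

(** * Bounds and limits of the weights *)

Lemma is_lim_seq_rfac p : is_lim_seq (fun N => rfac N p) 1.
Proof.
  induction p as [|p IH]; [apply is_lim_seq_const|].
  cbn [rfac]. replace 1 with (1 * (1 - 2 * INR (S p) * 0)) by ring.
  apply is_lim_seq_mult'; [exact IH|].
  apply (is_lim_seq_ext (fun N => 1 - 2 * INR (S p) * / (INR N + INR (S p)))).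
  - intros N. pose proof (pos_INR N). pose proof (INR_S_pos p). field. lra.
  - apply is_lim_seq_minus'; [apply is_lim_seq_const|].
    apply (is_lim_seq_scal_l _ (2 * INR (S p)) 0), is_lim_seq_inv_INR.
Qed.

(** The new factor lies in [0, 1] while [p <= n]; beyond that it is negative, but the product is
    already zero. *)
Lemma rfac_bounds n p : 0 <= rfac (S n) (S p) <= rfac (S n) p.
Proof.
  assert (F : (p <= n)%nat -> 0 <= (INR (S n) - INR (S p)) / (INR (S n) + INR (S p)) <= 1).
  { intros L. apply le_INR in L. pose proof (pos_INR p). rewrite !S_INR.
    split; [apply Rdiv_le_0_compat|apply Rle_div_l]; lra. }
  assert (P : 0 <= rfac (S n) p).
  { clear F. induction p as [|p IH]; [simpl; lra|]. cbn [rfac].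
    destruct (Nat.le_gt_cases p n) as [L|L].
    - apply Rmult_le_pos; [assumption|]. apply le_INR in L. pose proof (pos_INR p).
      rewrite !S_INR. apply Rdiv_le_0_compat; lra.
    - rewrite rfac_eq0 by lia. lra. }
  cbn [rfac]. destruct (Nat.le_gt_cases p n) as [L|L].
  - specialize (F L). nra.
  - rewrite rfac_eq0 by lia. lra.
Qed.

Lemma rfac_01 n p : 0 <= rfac (S n) p <= 1.
Proof.
  induction p as [|p IH]; [simpl; lra|]. pose proof (rfac_bounds n p). lra.
Qed.

Lemma wal_pos n : 0 < wal n.
Proof.
  induction n as [|n IH]; [simpl; lra|]. cbn [wal].
  pose proof (INR_S_pos n). pose proof (INR_S_pos (S n)). pose proof (od_pos (S n)).
  apply Rmult_lt_0_compat; [assumption|]. apply Rdiv_lt_0_compat; [nra|].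
  apply Rmult_lt_0_compat; lra.
Qed.

(** The Leibniz term damped by [rfac]; [wal n * walt n p] is the absolute value of
    [dker (S n) p]. *)
Definition walt (n p : nat) : R := rfac (S n) p / od p.

Lemma walt_bounds n p : 0 <= walt n p <= / od p.
Proof.
  unfold walt, Rdiv. pose proof (rfac_01 n p). pose proof (Rinv_0_lt_compat _ (od_pos p)). nra.
Qed.

(* The case k = 0 of [psum_dker_gker] evaluates this alternating series, and letting
   n tend to infinity compares it with the Leibniz series: this replaces Wallis' product. *)
Lemma wal_alternating n j :
  psum (tg_alt (walt n)) (2 * j + 1) - walt n (2 * j + 1) <= / wal n
  <= psum (tg_alt (walt n)) (2 * j + 1).
Proof.
  assert (D : Un_decreasing (walt n)).
  { intros p. unfold walt, Rdiv. pose proof (rfac_bounds n p).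
    apply Rmult_le_compat; try lra.
    - left. apply Rinv_0_lt_compat, od_pos.
    - apply Rinv_le_contravar; [apply od_pos|]. rewrite od_S. lra. }
  assert (Z : Un_cv (walt n) 0).
  { apply is_lim_seq_Reals. apply (is_lim_seq_le_le (fun _ => 0) _ (fun p => / od p)).
    - intros p. apply walt_bounds.
    - apply is_lim_seq_const.
    - apply is_lim_seq_inv_od. }
  assert (V : psum (tg_alt (walt n)) (S n) = / wal n).
  { pose proof (wal_pos n).
    apply (Rmult_eq_reg_l (wal n)); [|lra]. rewrite Rinv_r by lra.
    rewrite <- psum_scal, <- (psum_dker_gker n 0) by lia.
    apply psum_ext. intros p _. unfold dker, tg_alt, walt, ewt. simpl gker.
    field. apply od_neq0. }
  assert (C : Un_cv (fun N => sum_f_R0 (tg_alt (walt n)) N) (/ wal n)).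
  { apply is_lim_seq_Reals.
    apply (is_lim_seq_ext_loc (fun _ => / wal n)); [|apply is_lim_seq_const].
    exists n. intros N L. rewrite sum_f_R0_psum, <- V. symmetry.
    apply psum_extend; [lia|]. intros k Hk. unfold tg_alt, walt.
    rewrite rfac_eq0 by lia. unfold Rdiv. ring. }
  pose proof (alternated_series_ineq _ _ j D Z C) as I. rewrite !sum_f_R0_psum in I.
  (* Consecutive partial sums enclose the limit; the longer one is the shorter minus the term at
     [2 * j + 1]. *)
  replace (2 * j + 1)%nat with (S (2 * j)) by lia.
  cbn [psum] in I |- *. unfold tg_alt at 3 in I.
  rewrite pow_1_odd in I. lra.
Qed.

Lemma leibniz_alternating j :
  psum (tg_alt (fun p => / od p)) (2 * j + 1) - / od (2 * j + 1) <= PI / 4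
  <= psum (tg_alt (fun p => / od p)) (2 * j + 1).
Proof.
  assert (E : forall p, PI_tg p = / od p).
  { intros p. unfold PI_tg, od. rewrite plus_INR, mult_INR. simpl. f_equal. }
  pose proof (PI_ineq j) as I. rewrite !sum_f_R0_psum in I.
  replace (2 * j + 1)%nat with (S (2 * j)) by lia.
  rewrite !(psum_ext (tg_alt PI_tg) (tg_alt (fun p => / od p))) in I
    by (intros; unfold tg_alt; now rewrite E).
  cbn [psum] in I |- *. unfold tg_alt at 3 in I.
  rewrite pow_1_odd in I. lra.
Qed.

(** Cut at [2 * j + 1], the series for [/ wal n] and for PI / 4 both have error at most
    [/ od (2 * j + 1)], and the finite sums converge term by term. *)
Lemma is_lim_seq_wal : is_lim_seq wal (4 / PI).
Proof.
  assert (L : is_lim_seq (fun n => / wal n) (PI / 4)).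
  { apply (is_lim_seq_double _ _ (fun j n => psum (tg_alt (walt n)) (2 * j + 1))
            (fun j => psum (tg_alt (fun p => / od p)) (2 * j + 1))
            (fun j => / od (2 * j + 1))).
    - apply (is_lim_seq_subseq (fun N => / od N) 0 (fun j => (2 * j + 1)%nat));
        [|apply is_lim_seq_inv_od].
      apply eventually_subseq. intros; lia.
    - intros j n. pose proof (wal_alternating n j).
      pose proof (walt_bounds n (2 * j + 1)). apply Rabs_le_between. lra.
    - intros j. pose proof (leibniz_alternating j).
      apply Rabs_le_between.
      pose proof (Rinv_0_lt_compat _ (od_pos (2 * j + 1))). lra.
    - intros j. apply is_lim_seq_psum. intros k. unfold tg_alt, walt.
      apply (is_lim_seq_scal_l _ ((-1) ^ k) (/ od k)).
      replace (/ od k) with (1 * / od k) by ring.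
      apply is_lim_seq_mult'; [|apply is_lim_seq_const].
      apply (is_lim_seq_incr_1 (fun n => rfac n k) 1), is_lim_seq_rfac. }
  pose proof PI_RGT_0.
  apply (is_lim_seq_ext (fun n => / / wal n)); [intros; apply Rinv_inv|].
  replace (4 / PI) with (/ (PI / 4)) by (field; lra).
  apply (is_lim_seq_inv _ (PI / 4) L). intros E. injection E. lra.
Qed.

(** The bracket at [j = 0] gives [/ wal n >= 1 - 1/3]. *)
Lemma wal_le n : wal n <= 3 / 2.
Proof.
  pose proof (wal_alternating n 0) as [H _]. simpl in H. unfold tg_alt in H.
  pose proof (walt_bounds n 1) as B. unfold walt at 1 in H.
  assert (E0 : od 0 = 1) by (unfold od; simpl; lra).
  assert (E1 : od 1 = 3) by (unfold od; simpl; lra).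
  rewrite E0 in H. rewrite E1 in B. simpl in H.
  pose proof (wal_pos n).
  assert (I : 2 / 3 <= / wal n) by lra.
  apply Rinv_le_contravar in I; [|lra]. rewrite Rinv_inv in I. lra.
Qed.

Lemma ewt_bounds N p : 0 <= ewt N p <= 3 / 2.
Proof.
  destruct N as [|n]; simpl ewt; [lra|].
  pose proof (wal_pos n). pose proof (wal_le n). pose proof (rfac_01 n p). nra.
Qed.

Lemma is_lim_seq_ewt p : is_lim_seq (fun N => ewt N p) (4 / PI).
Proof.
  apply is_lim_seq_incr_1. simpl ewt. replace (4 / PI) with (4 / PI * 1) by ring.
  apply is_lim_seq_mult'; [apply is_lim_seq_wal|].
  apply (is_lim_seq_incr_1 (fun n => rfac n p) 1), is_lim_seq_rfac.
Qed.

(** * Dominated convergence for series *)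

Lemma psum_dominated_diff F f B j M :
  (j <= M)%nat -> (forall p, Rabs (F p) <= B * Rabs (f p)) ->
  Rabs (psum F M - psum F j)
  <= B * (psum (fun p => Rabs (f p)) M - psum (fun p => Rabs (f p)) j).
Proof.
  intros L H. induction L as [|M L IH].
  - replace (psum F j - psum F j) with 0 by ring. rewrite Rabs_R0. lra.
  - cbn [psum]. specialize (H M).
    replace (psum F M + F M - psum F j) with ((psum F M - psum F j) + F M) by ring.
    pose proof (Rabs_triang (psum F M - psum F j) (F M)). lra.
Qed.

Lemma psum_mono f N M : (forall p, 0 <= f p) -> (N <= M)%nat -> psum f N <= psum f M.
Proof.
  intros P L. induction L as [|M L IH]; [lra|]. cbn [psum]. specialize (P M). lra.
Qed.

(** Tannery's theorem with one limit [e0] for all weights: the tail [G - g j] of the absolute series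
    controls everything past a cut [j]. *)
Lemma tannery (e : nat -> nat -> R) (f : nat -> R) (B M e0 : R) :
  (forall N p, Rabs (e N p) <= B) ->
  (forall N p, (N <= p)%nat -> e N p = 0) ->
  (forall p, is_lim_seq (fun N => e N p) e0) ->
  (forall N, psum (fun p => Rabs (f p)) N <= M) ->
  exists L : R, is_lim_seq (psum f) L /\
    is_lim_seq (fun N => psum (fun p => e N p * f p) N) (e0 * L).
Proof.
  intros HB H0 He HM.
  pose (g := psum (fun p => Rabs (f p))).
  assert (X : ex_finite_lim_seq g).
  { apply (ex_finite_lim_seq_incr _ M); [|exact HM].
    intros N. unfold g. cbn [psum]. pose proof (Rabs_pos (f N)). lra. }
  destruct X as [G HG].
  assert (GB : forall N, g N <= G).
  { intros N. apply (is_lim_seq_incr_compare g G HG). intros n. unfold g. cbn [psum].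
    pose proof (Rabs_pos (f n)). lra. }
  assert (DG : is_lim_seq (fun j => G - g j) 0).
  { replace 0 with (G - G) by ring. apply is_lim_seq_minus'; [apply is_lim_seq_const|exact HG]. }
  assert (XL : ex_finite_lim_seq (psum f)).
  { apply ex_lim_seq_cauchy_corr. intros eps.
    apply is_lim_seq_spec in DG. destruct (DG eps) as [J HJ].
    assert (W : forall n m, (J <= n)%nat -> (n <= m)%nat -> Rabs (psum f m - psum f n) < eps).
    { intros n m Ln Lm.
      pose proof (psum_dominated_diff f f 1 n m Lm ltac:(intros; lra)) as Q.
      specialize (HJ n Ln). rewrite Rminus_0_r in HJ.
      apply Rabs_lt_between in HJ. specialize (GB m).
      change (psum (fun p => Rabs (f p)) m) with (g m) in Q.
      change (psum (fun p => Rabs (f p)) n) with (g n) in Q. lra. }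
    exists J. intros n m Ln Lm. destruct (Nat.le_ge_cases n m) as [L|L].
    - rewrite Rabs_minus_sym. now apply W.
    - now apply W. }
  destruct XL as [L HL]. exists L. split; [exact HL|].
  assert (B0 : 0 <= B) by (specialize (HB 0%nat 0%nat); pose proof (Rabs_pos (e 0%nat 0%nat)); lra).
  assert (D : forall j, Rabs (L - psum f j) <= G - g j).
  { intros j.
    assert (I : Rbar_le (Rabs (L - psum f j)) (G - g j)); [|exact I].
    apply (is_lim_seq_le_loc (fun N => Rabs (psum f N - psum f j)) (fun N => g N - g j)).
    - exists j. intros N LN.
      pose proof (psum_dominated_diff f f 1 j N LN ltac:(intros; lra)) as Q.
      unfold g. lra.
    - apply (is_lim_seq_abs _ (L - psum f j)), is_lim_seq_minus'; [exact HL|apply is_lim_seq_const].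
    - apply is_lim_seq_minus'; [exact HG|apply is_lim_seq_const]. }
  apply (is_lim_seq_double _ _ (fun j N => psum (fun p => e N p * f p) j)
           (fun j => e0 * psum f j) (fun j => (B + Rabs e0) * (G - g j))).
  - replace 0 with ((B + Rabs e0) * 0) by ring.
    now apply (is_lim_seq_scal_l _ (B + Rabs e0) 0).
  - intros j N. specialize (D j) as Dj.
    (* The cut [j] may exceed [N]; as [e N p] vanishes from [p = N] on, the sum can be prolonged to
       the maximum of the two. *)
    pose proof (psum_dominated_diff (fun p => e N p * f p) f B j (Nat.max N j) ltac:(lia)) as Q.
    rewrite (psum_extend _ N (Nat.max N j)) in Q;
      [|lia|intros p Hp; rewrite H0 by lia; ring].
    pose proof (GB (Nat.max N j)) as GN. unfold g in GN at 1.
    pose proof (GB j) as Gj. pose proof (Rabs_pos e0).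
    eapply Rle_trans; [apply Q|].
    + intros p. rewrite Rabs_mult. apply Rmult_le_compat_r; [apply Rabs_pos|apply HB].
    + unfold g in *. nra.
  - intros j. rewrite <- Rmult_minus_distr_l, Rabs_mult.
    specialize (D j). pose proof (Rabs_pos e0). pose proof (GB j). nra.
  - intros j. rewrite <- psum_scal. apply is_lim_seq_psum. intros k.
    apply is_lim_seq_mult'; [apply He|apply is_lim_seq_const].
Qed.

(** * Absolute convergence of the alternating values *)

Lemma talt_trunc_pos l p : 0 <= talt_trunc (map (fun s => (s, 1)) l) p.
Proof.
  revert p. induction l as [|s l IH]; intros p; [simpl; lra|].
  cbn [map]. rewrite talt_trunc_cons.
  induction p as [|p IHp]; [simpl; lra|]. cbn [psum].
  apply Rplus_le_le_0_compat; [assumption|].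
  apply Rmult_le_pos; [|apply IH]. rewrite pow1.
  apply Rdiv_le_0_compat; [lra|apply pow_lt, od_pos].
Qed.

(* Summing over the outermost index first, 1 / od k ^ 2 telescopes to an extra
   factor 1 / od at the next index, which again has exponent at least 2. *)
Lemma talt_abs_bounded s l :
  (2 <= s)%nat -> List.Forall (le 1) l ->
  exists M, forall N,
    psum (fun k => / od k ^ s * talt_trunc (map (fun s => (s, 1)) l) k) N <= M.
Proof.
  intros Hs Hl.
  (* The constant 3/2 gives equality at [k = 0]. *)
  assert (T : forall k s, (2 <= s)%nat ->
            / od k ^ s <= 3 / 2 * / od k - 3 / 2 * / od (S k)).
  { clear. intros k s Hs. pose proof (pos_INR k). pose proof (od_pos k).
    assert (/ od k ^ s <= / od k ^ 2).
    { apply Rinv_le_contravar; [apply pow_lt, od_pos|].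
      apply Rle_pow; [unfold od; lra|assumption]. }
    eapply Rle_trans; [eassumption|]. rewrite od_S.
    replace (3 / 2 * / od k - 3 / 2 * / (od k + 2)) with (3 * od k / (od k + 2) * / od k ^ 2)
      by (field; lra).
    rewrite <- (Rmult_1_l (/ od k ^ 2)) at 1. apply Rmult_le_compat_r.
    - left. apply Rinv_0_lt_compat, pow_lt, od_pos.
    - apply Rle_div_r; unfold od in *; lra. }
  revert s Hs. induction Hl as [|y l Hy Hl IH]; intros s Hs.
  - exists (3 / 2). intros N. cbn [map talt_trunc].
    assert (Q : psum (fun k => / od k ^ s * 1) N <= 3 / 2 - 3 / 2 * / od N).
    2: { pose proof (Rinv_0_lt_compat _ (od_pos N)). lra. }
    induction N as [|N IHN]; [unfold od; simpl; lra|]. cbn [psum].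
    specialize (T N s Hs). lra.
  - destruct (IH (S y) ltac:(lia)) as [M HM]. exists (3 / 2 * M). intros N.
    cbn [map]. set (t := fun k => / od k ^ y * talt_trunc (map (fun s => (s, 1)) l) k).
    assert (P : forall k, 0 <= t k).
    { intros k. apply Rmult_le_pos; [|apply talt_trunc_pos].
      left. apply Rinv_0_lt_compat, pow_lt, od_pos. }
    rewrite (psum_ext _ (fun k => / od k ^ s * psum t k)).
    2: { intros k _. rewrite talt_trunc_cons. f_equal. apply psum_ext. intros j _.
         unfold t. rewrite pow1. unfold Rdiv. ring. }
    specialize (HM N).
    rewrite (psum_ext _ (fun k => / od k * t k)) in HM.
    2: { intros k _. unfold t. simpl. rewrite Rinv_mult. ring. }
    assert (P0 : forall k, 0 <= psum t k) by (intros k; apply (psum_mono t 0 k P); lia).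
    (* The nonnegative boundary term of the telescoping is kept so that the induction closes. *)
    assert (Q : psum (fun k => / od k ^ s * psum t k) N + 3 / 2 * / od N * psum t N
                <= 3 / 2 * psum (fun k => / od k * t k) N).
    { clear HM. induction N as [|N IHN]; [simpl; lra|]. cbn [psum].
      specialize (T N s Hs). specialize (P0 N). specialize (P N).
      pose proof (Rinv_0_lt_compat _ (pow_lt _ s (od_pos N))).
      pose proof (Rmult_le_compat_r _ _ _ P0 T).
      assert (/ od (S N) <= / od N)
        by (apply Rinv_le_contravar; [apply od_pos|rewrite od_S; lra]).
      pose proof (Rmult_le_compat_r _ _ _ P H1). lra. }
    pose proof (Rinv_0_lt_compat _ (od_pos N)). specialize (P0 N).
    pose proof (Rmult_le_pos _ _ (Rlt_le _ _ H) P0). lra.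
Qed.

Lemma add_last_pos m l : List.Forall (le 1) l -> List.Forall (le 1) (add_last m l).
Proof.
  intros H. induction H as [|x l Hx Hl IH]; [constructor|].
  destruct l as [|y l].
  - repeat constructor. lia.
  - constructor; assumption.
Qed.

(** [tannery] with weights [ewt], whose limit is 4 / PI. The leading exponent 2a + 1 + x is at least
    2, so [talt_abs_bounded] supplies the majorant. *)
Lemma talt_limits a b l :
  l <> [] -> List.Forall (le 1) l ->
  is_lim_seq (fun N => psum (fun p => ewt N p * ((-1) ^ S p / od p ^ (2 * a + 1) * cterm b l p)) N)
    (4 / PI * talt (mk_index a b l)).
Proof.
  intros NE H. apply (add_last_pos (2 * b + 1)) in H.
  unfold cterm, mk_index.
  destruct (add_last (2 * b + 1) l) as [|x rest] eqn:E.
  { destruct l as [|y [|z l]]; easy. }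
  inversion H as [|? ? Hx Hr]; subst.
  set (f := fun p => (-1) ^ S p / od p ^ (2 * a + 1)
              * (/ od p ^ x * talt_trunc (map (fun s => (s, 1)) rest) p)).
  destruct (talt_abs_bounded (2 * a + 1 + x) rest ltac:(lia) Hr) as [M HM].
  destruct (tannery ewt f (3 / 2) M (4 / PI)) as (L & H1 & H2).
  - intros N p. pose proof (ewt_bounds N p). rewrite Rabs_right; lra.
  - apply ewt_eq0.
  - apply is_lim_seq_ewt.
  - intros N. eapply Rle_trans; [|apply (HM N)]. right. apply psum_ext. intros p _.
    unfold f, Rdiv. rewrite !Rabs_mult, pow_1_abs.
    assert (P : forall n, Rabs (/ od p ^ n) = / od p ^ n).
    { intros n. apply Rabs_right. left. apply Rinv_0_lt_compat, pow_lt, od_pos. }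
    rewrite !P, (Rabs_right (talt_trunc _ p)) by (apply Rle_ge, talt_trunc_pos).
    rewrite (pow_add _ (2 * a + 1)), Rinv_mult. ring.
  - unfold talt. rewrite (is_lim_seq_unique _ L); [exact H2|].
    apply (is_lim_seq_ext (psum f)); [|exact H1].
    intros N. rewrite talt_trunc_cons. apply psum_ext. intros p _.
    unfold f, Rdiv. rewrite (pow_add _ (2 * a + 1)), Rinv_mult. ring.
Qed.

Theorem theorem4p4 (a b c : nat) (hc : (1 <= c)%nat) :
  tstar (twos a ++ [(c + 3)%nat] ++ twos b) =
  - (2 / PI) *
    lsum (map (fun r => 2 ^ r *
                 lsum (map (fun l => talt (mk_index a b l)) (compositions (c + 2) r)))
              (seq 1 (c + 2))).
Proof.
  unfold tstar.
  match goal with |- _ = ?r => rewrite (is_lim_seq_unique _ r); [reflexivity|] end.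
  set (Y := fun N l => psum (fun p => ewt N p * ((-1) ^ S p / od p ^ (2 * a + 1) * cterm b l p)) N).
  apply (is_lim_seq_ext (fun N => - / 2 * lsum (map (fun r => 2 ^ r *
     lsum (map (Y N) (compositions (c + 2) r))) (seq 1 (c + 2))))).
  (* The identity holds for each [p]: the 1/2 undoes the 2 of [wsum_qsum], and the minus sign comes
     from (-1)^p against (-1)^(p+1). *)
  - intros N. rewrite tstar_trunc_dker, lsum_seq1.
    unfold Y.
    rewrite (psum_ext _ (fun r => psum (fun p => ewt N p * ((-1) ^ S p / od p ^ (2 * a + 1))
       * (2 ^ S r * csum b (c + 2) (S r) p)) N)).
    + rewrite <- psum_swap, <- psum_scal. apply psum_ext. intros p _.
      rewrite psum_scal.
      change (psum _ (c + 2)) with (wsum b (c + 2) p).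
      replace (c + 2)%nat with (S (S c)) by lia. replace (c + 3)%nat with (S (S (S c))) by lia.
      rewrite wsum_qsum. unfold dker. rewrite (pow_add _ (2 * a) 1). simpl pow.
      field. split; [apply pow_nonzero|]; apply od_neq0.
    + intros r _. rewrite <- psum_lsum, <- psum_scal. apply psum_ext. intros p _.
      unfold csum. rewrite <- !lsum_scal. apply lsum_ext. intros l _. ring.
  - match goal with |- is_lim_seq _ (Finite (_ * ?s)) =>
      replace (- (2 / PI) * s) with (- / 2 * (4 / PI * s)) by (field; apply PI_neq0) end.
    apply (is_lim_seq_scal_l _ (- / 2) (4 / PI * _)).
    rewrite <- lsum_scal. apply is_lim_seq_lsum. intros r Hr.
    rewrite <- Rmult_assoc, (Rmult_comm (4 / PI)), Rmult_assoc, <- lsum_scal.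
    apply (is_lim_seq_scal_l _ (2 ^ r) (lsum _)).
    apply is_lim_seq_lsum. intros l Hl.
    apply compositions_pos in Hl as [E F]. apply talt_limits; [|exact F].
    intros ->. apply in_seq in Hr. simpl in E. lia.
Qed.
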